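(* Let $V$ be a real inner product space of finite dimension $n\ge 1$ with a fixed ordered orthonormal basis $(e_1,\ldots,e_n)$, and let $S$ be the geometric orientation of ordered bases of $V$ with respect to $(e_1,\ldots,e_n)$, as defined in the context. Then for every ordered basis $(v_1,\ldots,v_n)$ of $V$, every index $i\in\{1,\ldots,n\}$ and every real $t\neq 0$, $$S(v_1,\ldots,v_{i-1},tv_i,v_{i+1},\ldots,v_n)=\frac{t}{|t|}\,S(v_1,\ldots,v_n).$$
   Context: $V$ is a real inner product space of dimension $n$, with inner product $u\cdot v$, norm $|\cdot|$, and a fixed ordered orthonormal basis $(e_1,\ldots,e_n)$. Rotations. For noncollinear unit vectors $u,w$, put $\widehat{u}=\dfrac{u-(w\cdot u)w}{|u-(w\cdot u)w|}$ and, for $t\in\mathbb{R}$, $v\in V$, $$R_{u,w}^t v = v-(\widehat u\cdot v)\widehat u-(w\cdot v)w+(\cos(t)(\widehat u\cdot v)-\sin(t)(w\cdot v))\widehat u+(\sin(t)(\widehat u\cdot v)+\cos(t)(w\cdot v))w,$$ and $T_{u,w}=\dfrac{\widehat u\cdot u}{|\widehat u\cdot u|}\arccos(w\cdot u)$. One has $R_{u,w}^0v=v$ and $R_{u,w}^{T_{u,w}}u=w$. Orientation of orthonormal bases. The orientation $S_n(u_1,\ldots,u_n)\in\{1,-1\}$ of an ordered orthonormal basis $(u_1,\ldots,u_n)$ with respect to $(e_1,\ldots,e_n)$ is defined inductively on $n$: (n=1) $S_1(u_1)=1$ if $u_1=e_1$ and $S_1(u_1)=-1$ if $u_1=-e_1$.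 (n=2) For $k=1,2$ let $c_k(t)=(\cos(t)(e_1\cdot u_k)-\sin(t)(e_2\cdot u_k))e_1+(\sin(t)(e_1\cdot u_k)+\cos(t)(e_2\cdot u_k))e_2$, and $T_2=\dfrac{e_1\cdot u_2}{|e_1\cdot u_2|}\arccos(e_2\cdot u_2)$ (if $e_1\cdot u_2=0$, the sign factor may be taken to be $1$ or $-1$; this does not affect the outcome). Then $c_2(T_2)=e_2$ and $c_1(T_2)=\pm e_1$; set $S_2(u_1,u_2)=1$ if $c_1(T_2)=e_1$ and $-1$ if $c_1(T_2)=-e_1$. (n≥3) If $u_n\ne\pm e_n$, set $S_n(u_1,\ldots,u_n)=S_{n-1}(R_{u_n,e_n}^{T_n}u_1,\ldots,R_{u_n,e_n}^{T_n}u_{n-1})$ with $T_n=T_{u_n,e_n}$, where the orthonormal vectors on the right form an ordered orthonormal basis of the span of $(e_1,\ldots,e_{n-1})$ and $S_{n-1}$ is the orientation with respect to $(e_1,\ldots,e_{n-1})$. If $u_n=\pm e_n$, $S_n(u_1,\ldots,u_n)$ is defined as the common value of $S_n(u_1',\ldots,u_n')$ for all ordered orthonormal bases $(u_1',\ldots,u_n')$ sufficiently close to $(u_1,\ldots,u_n)$ with $u_n'\ne\pm e_n$ (this is well defined). Orientation of general bases. For an ordered basis $(v_1,\ldots,v_n)$ of $V$, $S(v_1,\ldots,v_n)=S_n(G(v_1,\ldots,v_n))$, where $G(v_1,\ldots,v_n)=(u_1,\ldots,u_n)$ is the Gram–Schmidt orthonormalization: $u_1=v_1/|v_1|$, $u_i=\dfrac{v_i-\sum_{j<i}(v_i\cdot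 u_j)u_j}{|v_i-\sum_{j<i}(v_i\cdot u_j)u_j|}$. *)

(* Defs.v *)
From HB Require Import structures.
From mathcomp Require Import all_boot all_order all_algebra.
From mathcomp Require Import all_classical all_reals all_analysis.

Set Implicit Arguments.
Unset Strict Implicit.
Unset Printing Implicit Defensive.

Import Order.TTheory GRing.Theory Num.Theory.
Local Open Scope classical_set_scope.
Local Open Scope ring_scope.

Section Orientation.
Context {R : realType} {V : vectType R} (dot : {dot V for idfun}).

Definition dnorm (v : V) : R := Num.sqrt (dot v v).

Definition ordered_onb k (U : {vspace V}) (u : k.-tuple V) : bool :=
  basis_of U u && orthonormal dot u.

(* The vector written u with a hat; meaningful when u and w are noncollinear
   unit vectors. *)
Definition hat (u w : V) : V :=
  (dnorm (u - dot w u *: w))^-1 *: (u - dot w u *: w).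

Definition rotation (u w : V) (t : R) (v : V) : V :=
  v - dot (hat u w) v *: hat u w - dot w v *: w
  + (cos t * dot (hat u w) v - sin t * dot w v) *: hat u w
  + (sin t * dot (hat u w) v + cos t * dot w v) *: w.

Definition rotation_angle (u w : V) : R :=
  dot (hat u w) u / `|dot (hat u w) u| * acos (dot w u).

Definition rotation2 (e1 e2 : V) (t : R) (u : V) : V :=
  (cos t * dot e1 u - sin t * dot e2 u) *: e1
  + (sin t * dot e1 u + cos t * dot e2 u) *: e2.

(* When e1 and u are orthogonal the sign factor may be 1 or -1, but not 0, which
   is the value of 0 / 0 in R: we take it to be 1. *)
Definition rotation2_angle (e1 e2 u : V) : R :=
  (if dot e1 u == 0 then 1 else dot e1 u / `|dot e1 u|) * acos (dot e2 u).

(* Orientation of the orthonormal basis u of the span <<e>> with respect to the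
   orthonormal basis e of <<e>>.  Keeping the vectors in the ambient space V
   lets the recursion go from <<e_1, .., e_n>> to <<e_1, .., e_(n-1)>>.
   For n >= 3 and u_n = e_n or - e_n, xget selects the common value taken on the
   orthonormal bases x close to u with x_n different from e_n and - e_n.
   The values for n = 0, for a u that is not an orthonormal basis of <<e>>, and
   the default value of xget are conventional. *)
Fixpoint onb_orientation n : n.-tuple V -> n.-tuple V -> R :=
  match n with
  | 0 => fun _ _ => 1
  | k.+1 => fun e u =>
    let en := tnth e ord_max in
    let un := tnth u ord_max in
    match k return R with
    | 0 => if un == en then 1 else -1
    | 1 =>
      let e1 := tnth e ord0 in
      let T := rotation2_angle e1 en un in
      if rotation2 e1 en T (tnth u ord0) == e1 then 1 else -1
    | _ =>
      let generic (x : k.+1.-tuple V) : R :=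
        let xn := tnth x ord_max in
        let T := rotation_angle xn en in
        onb_orientation
          [tuple tnth e (widen_ord (leqnSn k) i) | i < k]
          [tuple rotation xn en T (tnth x (widen_ord (leqnSn k) i)) | i < k] in
      if (un == en) || (un == - en) then
        xget 1 [set s : R | exists2 eps : R, 0 < eps &
          forall x : k.+1.-tuple V,
            ordered_onb <<e>>%VS x ->
            (forall i, dnorm (tnth x i - tnth u i) < eps) ->
            tnth x ord_max != en -> tnth x ord_max != - en ->
            generic x = s]
      else generic u
    end
  end.

Definition gram_schmidt_step (us : seq V) (v : V) : seq V :=
  let w := v - \sum_(u <- us) dot v u *: u in
  rcons us ((dnorm w)^-1 *: w).

Definition gram_schmidt (vs : seq V) : seq V := foldl gram_schmidt_step [::] vs.

Lemma size_gram_schmidt (vs : seq V) : size (gram_schmidt vs) = size vs.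
Proof.
rewrite /gram_schmidt -[RHS]add0n -[X in (X + _)%N]/(size (@nil V)).
elim: vs [::] => [|v vs IHvs] us /=; first by rewrite addn0.
by rewrite IHvs size_rcons addSnnS.
Qed.

Definition gram_schmidt_tuple n (v : n.-tuple V) : n.-tuple V :=
  Tuple (introT eqP (etrans (size_gram_schmidt v) (size_tuple v))).

Definition orientation n (e v : n.-tuple V) : R :=
  onb_orientation e (gram_schmidt_tuple v).

End Orientation.

(* Main.v *)
(* The orientation of an orthonormal basis u with respect to e is the determinant
   of the matrix of inner products e_i . u_j.  By induction on n: the rotation
   taking u_n to e_n has determinant 1, and afterwards the last column of the
   matrix is (0, .., 0, 1), so the determinant is the one of the first n - 1
   vectors.  When u_n = e_n or - e_n, determinants of orthonormal bases close to
   u agree with that of u, being 1 or -1 and less than 2 apart; and such bases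
   with last vector other than e_n and - e_n exist, by rotating u slightly in the
   plane of e_1 and e_n, so the common value is unique.  Finally, replacing v_i
   by t v_i multiplies the i-th Gram-Schmidt vector by t / |t| and fixes the
   others. *)
Require Import Defs.
From HB Require Import structures.
From mathcomp Require Import all_boot all_order all_algebra all_fingroup.
From mathcomp Require Import all_classical all_reals all_analysis.
From mathcomp Require Import ring lra.

Set Implicit Arguments.
Unset Strict Implicit.
Unset Printing Implicit Defensive.

Import Order.TTheory GRing.Theory Num.Theory.
Local Open Scope ring_scope.

(** * Continuity and column rules for determinants *)

Section Determinants.
Context {R : realFieldType}.

(** Telescoping: [a * b - c * d = (a - c) * b + c * (b - d)], where [b] and [c] have absolute value
    at most 1. *)
Lemma ler_dist_prod (I : Type) (r : seq I) (f g : I -> R) :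
  (forall i, `|f i| <= 1) -> (forall i, `|g i| <= 1) ->
  `|\prod_(i <- r) f i - \prod_(i <- r) g i| <= \sum_(i <- r) `|f i - g i|.
Proof.
move=> f1 g1; elim: r => [|i r IHr]; first by rewrite !big_nil subrr normr0.
rewrite !big_cons.
have -> : forall a b c d : R, a * b - c * d = (a - c) * b + c * (b - d).
  by move=> a b c d; ring.
apply: le_trans (ler_normD _ _) _; rewrite !normrM; apply: lerD.
  rewrite ler_piMr// normr_prod.
  by apply: prodr_ile1 => j _; rewrite normr_ge0 f1.
by apply: le_trans IHr; rewrite ler_piMl.
Qed.

(** Termwise comparison in the Leibniz formula: [n!] permutations, each contributing at most [n]
    entry differences. *)
Lemma ler_dist_det n (A B : 'M[R]_n) (eps : R) :
  (forall i j, `|A i j| <= 1) -> (forall i j, `|B i j| <= 1) ->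
  (forall i j, `|A i j - B i j| <= eps) ->
  `|\det A - \det B| <= (n`! * n)%:R * eps.
Proof.
move=> A1 B1 AB; rewrite /determinant -sumrB.
apply: le_trans (ler_norm_sum _ _ _) _.
have -> : (n`! * n)%:R * eps = \sum_(s : {perm 'I_n}) \sum_(i < n) eps.
  by rewrite !sumr_const card_ord card_Sn -mulrnA mulnC mulr_natl.
apply: ler_sum => s _.
rewrite -mulrBr normrM normr_sign mul1r.
by apply: le_trans (ler_dist_prod _ _ _) _ => //; apply: ler_sum.
Qed.

Lemma det_mx22 (A : 'M[R]_2) :
  \det A = A ord0 ord0 * A ord_max ord_max - A ord0 ord_max * A ord_max ord0.
Proof.
rewrite (expand_det_row _ ord0) !big_ord_recl big_ord0 addr0 /cofactor !det_mx11 !mxE.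
have -> : lift ord0 ord0 = ord_max :> 'I_2 by apply/val_inj.
have -> : lift ord_max 0 = ord0 :> 'I_2 by apply/val_inj.
by rewrite /= expr0 expr1 mul1r mulN1r mulrN.
Qed.

(** Laplace expansion along the last column, whose only nonzero entry is the corner; the cofactor
    sign has even exponent [n + n]. *)
Lemma det_last_col n (A : 'M[R]_n.+1) :
  (forall i, A i ord_max = (i == ord_max)%:R) ->
  \det A = \det (\matrix_(i, j) A (widen_ord (leqnSn n) i) (widen_ord (leqnSn n) j)).
Proof.
move=> Amax; rewrite (expand_det_col _ ord_max) (bigD1 ord_max)//= big1 => [|i /negbTE i_max].
  rewrite Amax eqxx mul1r addr0 /cofactor addnn -signr_odd odd_double mul1r.
  congr (\det _); apply/matrixP => i j; rewrite !mxE.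
  by congr (A _ _); apply/val_inj; exact: lift_max.
by rewrite Amax i_max mul0r.
Qed.

(** [B] is [A] times a diagonal matrix of determinant [c]. *)
Lemma det_scale_col n (A B : 'M[R]_n) (j0 : 'I_n) (c : R) :
  (forall i j, B i j = (if j == j0 then c else 1) * A i j) -> \det B = c * \det A.
Proof.
move=> BA; have -> : B = A *m diag_mx (\row_j (if j == j0 then c else 1)).
  by apply/matrixP => i j; rewrite mul_mx_diag !mxE BA mulrC.
rewrite det_mulmx det_diag mulrC (bigD1 j0)//= big1 => [|j /negbTE jj0].
  by rewrite mxE eqxx mulr1.
by rewrite mxE jj0.
Qed.

End Determinants.

(** * Inner product rules and orthonormal families *)

Section OrthonormalBases.
Context {R : realType} {V : vectType R} (dot : {dot V for idfun}).

Lemma dotC x y : dot x y = dot y x.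
Proof. by rewrite (hermC dot) expr0 mul1r. Qed.

Lemma dotDl x y z : dot (x + y) z = dot x z + dot y z.
Proof. exact: linearDl. Qed.

Lemma dotDr x y z : dot x (y + z) = dot x y + dot x z.
Proof. exact: linearDr. Qed.

Lemma dotNl x y : dot (- x) y = - dot x y.
Proof. exact: linearNl. Qed.

Lemma dotNr x y : dot x (- y) = - dot x y.
Proof. exact: linearNr. Qed.

Lemma dotZl a x y : dot (a *: x) y = a * dot x y.
Proof. exact: linearZl_LR. Qed.

Lemma dotZr a x y : dot x (a *: y) = a * dot x y.
Proof. by rewrite dotC dotZl dotC. Qed.

Lemma dot0l x : dot 0 x = 0.
Proof. exact: linear0l. Qed.

Lemma dot0r x : dot x 0 = 0.
Proof. exact: linear0r. Qed.

Lemma dot_suml I (r : seq I) (P : pred I) F x :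
  dot (\sum_(i <- r | P i) F i) x = \sum_(i <- r | P i) dot (F i) x.
Proof. exact: linear_sumlz. Qed.

Lemma dot_sumr I (r : seq I) (P : pred I) F x :
  dot x (\sum_(i <- r | P i) F i) = \sum_(i <- r | P i) dot x (F i).
Proof. exact: linear_sumr. Qed.

Definition dotE := (dotDl, dotDr, dotNl, dotNr, dotZl, dotZr).

Lemma dot_gt0 x : x != 0 -> 0 < dot x x.
Proof. exact: neq0_dnorm_gt0. Qed.

Lemma dot_ge0 x : 0 <= dot x x.
Proof. by have [->|/dot_gt0/ltW//] := eqVneq x 0; rewrite dot0l. Qed.

Lemma dot_eq0 x : (dot x x == 0) = (x == 0).
Proof.
have [->|/dot_gt0/gt_eqF//] := eqVneq x 0.
by rewrite dot0l eqxx.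
Qed.

Lemma dnormZ a x : dnorm dot (a *: x) = `|a| * dnorm dot x.
Proof. by rewrite /dnorm !dotE mulrA -expr2 sqrtrM ?sqr_ge0// sqrtr_sqr. Qed.

Lemma dnorm_normalize x : x != 0 ->
  dot ((dnorm dot x)^-1 *: x) ((dnorm dot x)^-1 *: x) = 1.
Proof.
move=> x0; rewrite !dotE mulrA -expr2 exprVn sqr_sqrtr ?dot_ge0//.
by rewrite mulVf// dot_eq0.
Qed.

Lemma orthonormalP (s : seq V) :
  reflect (forall i j, (i < size s)%N -> (j < size s)%N ->
             dot s`_i s`_j = (i == j)%:R)
          (orthonormal dot s).
Proof.
elim: s => [|x s IHs]; first by left.
have -> : orthonormal dot (x :: s) =
    [&& dot x x == 1, all [pred y | dot x y == 0] s & orthonormal dot s].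
  rewrite /orthonormal /ortho_rec /= andbT -!andbA; do ?bool_congr.
apply: (iffP and3P) => [[/eqP xx /allP xs /IHs os] [|i] [|j] //= ilt jlt|os].
- by apply/eqP/xs/mem_nth.
- by rewrite dotC; apply/eqP/xs/mem_nth.
- exact: os.
split; first by rewrite (os 0 0)%N.
  apply/allP => y ys; have := os 0%N (index y s).+1 isT.
  by rewrite /= ltnS index_mem nth_index// => /(_ ys) ->.
by apply/IHs => i j ilt jlt; rewrite (os i.+1 j.+1).
Qed.

Lemma orthonormal_tuple_free k (u : k.-tuple V) :
  (forall i j, dot (tnth u i) (tnth u j) = (i == j)%:R) -> free u.
Proof.
move=> ou; apply/freeP => c c0 i; have := congr1 (dot (tnth u i)) c0.
rewrite dot_sumr (bigD1 i)//= big1 => [|j /negbTE ji].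
  by rewrite dotZr -tnth_nth ou eqxx mulr1 addr0 dot0r.
by rewrite dotZr -tnth_nth ou eq_sym ji mulr0.
Qed.

(** Orthonormal vectors are free, so lying in [U] and matching its dimension makes them a basis. *)
Lemma ordered_onbP (U : {vspace V}) k (u : k.-tuple V) :
  reflect [/\ \dim U = k, forall i, tnth u i \in U &
             forall i j, dot (tnth u i) (tnth u j) = (i == j)%:R]
          (ordered_onb dot U u).
Proof.
apply: (iffP andP) => [[bu /orthonormalP ou]|[dimU uU ou]].
  split=> [|i|i j]; first exact: size_basis bu.
  - by apply: (basis_mem bu); rewrite mem_tnth.
  - by rewrite !(tnth_nth 0) ou ?size_tuple.
split; last first.
  apply/orthonormalP => i j; rewrite size_tuple => ik jk.
  by rewrite -(tnth_nth 0 u (Ordinal ik)) -(tnth_nth 0 u (Ordinal jk)) ou.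
rewrite basisEfree size_tuple dimU leqnn andbT orthonormal_tuple_free//=.
by apply/span_subvP => x /tnthP[i ->].
Qed.

Lemma ordered_onb_span k (u : k.-tuple V) :
  (forall i j, dot (tnth u i) (tnth u j) = (i == j)%:R) -> ordered_onb dot <<u>> u.
Proof.
move=> ou; apply/ordered_onbP; split=> // [|i].
  by rewrite (eqP (orthonormal_tuple_free ou)) size_tuple.
by rewrite memv_span// mem_tnth.
Qed.

Lemma onb_expand (U : {vspace V}) k (u : k.-tuple V) x :
  ordered_onb dot U u -> x \in U -> x = \sum_i dot (tnth u i) x *: tnth u i.
Proof.
move=> /[dup] /ordered_onbP[_ _ ou] /andP[/span_basis <- _] /coord_span.
set c := coord u => xE; rewrite {1}xE; apply: eq_bigr => i _.
rewrite -tnth_nth [in RHS]xE dot_sumr (bigD1 i)//= big1 => [|j /negbTE ji].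
  by rewrite -tnth_nth dotZr ou eqxx mulr1 addr0.
by rewrite -tnth_nth dotZr ou eq_sym ji mulr0.
Qed.

(** * Gram matrices between orthonormal bases *)

Definition gram k (x y : k.-tuple V) : 'M[R]_k :=
  \matrix_(i, j) dot (tnth x i) (tnth y j).

Lemma gram_mul (U : {vspace V}) k (e x y : k.-tuple V) :
  ordered_onb dot U e -> (forall j, tnth y j \in U) ->
  gram x e *m gram e y = gram x y.
Proof.
move=> eU yU; apply/matrixP => i j; rewrite !mxE.
rewrite [in RHS](onb_expand eU (yU j)) dot_sumr; apply: eq_bigr => l _.
by rewrite !mxE dotZr mulrC.
Qed.

Lemma gram_onb (U : {vspace V}) k (u : k.-tuple V) :
  ordered_onb dot U u -> gram u u = 1%:M.
Proof. by case/ordered_onbP => _ _ ou; apply/matrixP => i j; rewrite !mxE ou. Qed.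

(** The change of basis matrix is orthogonal: its transpose [gram u e] times itself is [gram u u],
    the identity. *)
Lemma det_gram_sqr (U : {vspace V}) k (e u : k.-tuple V) :
  ordered_onb dot U e -> ordered_onb dot U u -> \det (gram e u) ^+ 2 = 1.
Proof.
move=> eU uU; rewrite expr2 -{1}det_tr -det_mulmx.
have -> : (gram e u)^T = gram u e by apply/matrixP => i j; rewrite !mxE dotC.
have [_ uinU _] := ordered_onbP _ _ uU.
by rewrite (gram_mul _ eU)// (gram_onb uU) det1.
Qed.

Lemma dot_onb_sqr (U : {vspace V}) k (e : k.-tuple V) x :
  ordered_onb dot U e -> x \in U -> dot x x = \sum_i dot (tnth e i) x ^+ 2.
Proof.
move=> eU xU; rewrite {1}(onb_expand eU xU) dot_suml.
by apply: eq_bigr => i _; rewrite dotZl expr2.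
Qed.

Lemma norm_dot_onb (U : {vspace V}) k (e : k.-tuple V) i x :
  ordered_onb dot U e -> x \in U -> `|dot (tnth e i) x| <= dnorm dot x.
Proof.
move=> eU xU; rewrite -sqrtr_sqr /dnorm ler_sqrt ?dot_ge0//.
rewrite (dot_onb_sqr eU xU) (bigD1 i)//= lerDl.
by apply: sumr_ge0 => j _; rewrite sqr_ge0.
Qed.

Lemma dnorm_onb (U : {vspace V}) k (u : k.-tuple V) i :
  ordered_onb dot U u -> dnorm dot (tnth u i) = 1.
Proof. by case/ordered_onbP => _ _ ou; rewrite /dnorm ou eqxx sqrtr1. Qed.

(** Both determinants are 1 or -1, and [ler_dist_det] puts them less than 2 apart. *)
Lemma det_gram_near (U : {vspace V}) k (e u x : k.-tuple V) (eps : R) :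
  ordered_onb dot U e -> ordered_onb dot U u -> ordered_onb dot U x ->
  (forall i, dnorm dot (tnth x i - tnth u i) <= eps) -> (k`! * k)%:R * eps < 2 ->
  \det (gram e x) = \det (gram e u).
Proof.
move=> eU uU xU xu eps_lt.
have [_ uinU _] := ordered_onbP _ _ uU; have [_ xinU _] := ordered_onbP _ _ xU.
have : `|\det (gram e x) - \det (gram e u)| < 2.
  apply: le_lt_trans eps_lt; apply: ler_dist_det => i j; rewrite !mxE.
  - by rewrite -(dnorm_onb j xU) (norm_dot_onb _ eU).
  - by rewrite -(dnorm_onb j uU) (norm_dot_onb _ eU).
  - by rewrite -dotNr -dotDr (le_trans (norm_dot_onb _ eU _))// memvB.
move: (det_gram_sqr eU uU) (det_gram_sqr eU xU) => /eqP + /eqP.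
rewrite !sqrf_eq1 => /orP[] /eqP-> /orP[] /eqP-> //;
  by rewrite ltr_norml => /andP[]; lra.
Qed.

(** * Rotations in the plane of two orthonormal vectors *)

Section PlaneRotation.
Variables (h w : V).
Hypotheses (hh : dot h h = 1) (ww : dot w w = 1) (hw : dot h w = 0).

(** Cosine and sine are free parameters [c] and [s], so that half angles and small rotations can be
    treated algebraically; it is a rotation when [c ^+ 2 + s ^+ 2 = 1]. *)
Definition plane_rotation (c s : R) (v : V) : V :=
  v + (((c - 1) * dot h v - s * dot w v) *: h
       + (s * dot h v + (c - 1) * dot w v) *: w).

Let wh : dot w h = 0. Proof. by rewrite dotC. Qed.

Lemma dot_plane_rotationl c s v :
  dot h (plane_rotation c s v) = c * dot h v - s * dot w v.
Proof. by rewrite !dotE hh hw; ring. Qed.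

Lemma dot_plane_rotationr c s v :
  dot w (plane_rotation c s v) = s * dot h v + c * dot w v.
Proof. by rewrite !dotE ww wh; ring. Qed.

Lemma dot_plane_rotation c s x y : c ^+ 2 + s ^+ 2 = 1 ->
  dot (plane_rotation c s x) (plane_rotation c s y) = dot x y.
Proof.
move=> cs; rewrite {2}/plane_rotation 2!dotDr 2!dotZr.
rewrite ![dot (plane_rotation c s x) _]dotC dot_plane_rotationl dot_plane_rotationr.
rewrite /plane_rotation 2!dotDr 2!dotZr ![dot y _]dotC.
transitivity (dot x y + (c ^+ 2 + s ^+ 2 - 1) * (dot h x * dot h y + dot w x * dot w y)).
  by ring.
by rewrite cs subrr mul0r addr0.
Qed.

Lemma plane_rotation_mem (U : {vspace V}) c s v :
  h \in U -> w \in U -> v \in U -> plane_rotation c s v \in U.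
Proof. by move=> hU wU vU; rewrite !memvD ?memvZ. Qed.

Lemma plane_rotation_double c s v :
  plane_rotation c s (plane_rotation c s v)
  = plane_rotation (c ^+ 2 - s ^+ 2) (2 * c * s) v.
Proof.
rewrite {1}/plane_rotation dot_plane_rotationl dot_plane_rotationr.
rewrite /plane_rotation -addrA; congr (_ + _).
rewrite addrACA -!scalerDl; congr (_ *: _ + _ *: _).
  by ring.
by ring.
Qed.

Lemma plane_rotation_onb (U : {vspace V}) k (u : k.-tuple V) c s :
  h \in U -> w \in U -> c ^+ 2 + s ^+ 2 = 1 -> ordered_onb dot U u ->
  ordered_onb dot U [tuple plane_rotation c s (tnth u i) | i < k].
Proof.
move=> hU wU cs /ordered_onbP[dimU uU ou]; apply/ordered_onbP; split=> // [i|i j].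
  by rewrite tnth_mktuple plane_rotation_mem.
by rewrite !tnth_mktuple dot_plane_rotation// ou.
Qed.

(* A rotation is the square of the rotation by half the angle, so its
   determinant is the square of a number whose square is 1. *)
Lemma det_gram_plane_rotation (U : {vspace V}) k (e u : k.-tuple V) t :
  h \in U -> w \in U -> ordered_onb dot U e -> ordered_onb dot U u ->
  \det (gram e [tuple plane_rotation (cos t) (sin t) (tnth u i) | i < k])
  = \det (gram e u).
Proof.
move=> hU wU eU uU.
have cs : cos (t / 2) ^+ 2 + sin (t / 2) ^+ 2 = 1 :> R := cos2Dsin2 _.
have -> : cos t = cos (t / 2) ^+ 2 - sin (t / 2) ^+ 2.
  by rewrite {1}(_ : t = t / 2 + t / 2) ?cosD ?expr2//; field.
have -> : sin t = 2 * cos (t / 2) * sin (t / 2).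
  by rewrite {1}(_ : t = t / 2 + t / 2) ?sinD//; field.
set c := cos (t / 2) in cs *; set s := sin (t / 2) in cs *.
pose rot (x : k.-tuple V) := [tuple plane_rotation c s (tnth x i) | i < k].
have rotU x : ordered_onb dot U x -> ordered_onb dot U (rot x).
  exact: plane_rotation_onb.
have gram_rot x y : gram (rot x) (rot y) = gram x y.
  by apply/matrixP => i j; rewrite !mxE !tnth_mktuple dot_plane_rotation.
have -> : [tuple plane_rotation (c ^+ 2 - s ^+ 2) (2 * c * s) (tnth u i) | i < k]
    = rot (rot u).
  by apply: eq_from_tnth => i; rewrite !tnth_mktuple plane_rotation_double.
have memU (x : k.-tuple V) : ordered_onb dot U x -> forall i, tnth x i \in U.
  by case/ordered_onbP.
(* Inserting the basis [rot e] and using that [rot] is an isometry, each of the two half rotations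
   splits off one factor [gram e (rot e)]. *)
rewrite -(gram_mul e (rotU _ eU) (memU _ (rotU _ (rotU _ uU)))) gram_rot.
rewrite -(gram_mul e (rotU _ eU) (memU _ (rotU _ uU))) gram_rot.
by rewrite !det_mulmx mulrA -expr2 (det_gram_sqr eU (rotU _ eU)) mul1r.
Qed.

(** The squared displacement is [2 - 2 * c] times the squared length of the projection of [v] to the
    plane, which is at most 1 by Bessel's inequality. *)
Lemma dnorm_plane_rotationB c s v : c ^+ 2 + s ^+ 2 = 1 -> c <= 1 ->
  dot v v = 1 -> dnorm dot (plane_rotation c s v - v) <= Num.sqrt (2 - 2 * c).
Proof.
move=> cs c1 vv.
have bessel : 0 <= 1 - dot h v ^+ 2 - dot w v ^+ 2.
  have -> : 1 - dot h v ^+ 2 - dot w v ^+ 2 =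
      dot (v - dot h v *: h - dot w v *: w) (v - dot h v *: h - dot w v *: w).
    by rewrite !dotE hh ww hw wh vv (dotC v h) (dotC v w); ring.
  exact: dot_ge0.
have c_le : 0 <= 2 - 2 * c by lra.
rewrite /dnorm ler_sqrt// /plane_rotation addrC addKr !dotE hh ww hw wh.
set a := dot h v in bessel *; set b := dot w v in bessel *.
have s2 : s ^+ 2 = 1 - c ^+ 2 by rewrite -cs addrAC subrr add0r.
rewrite -subr_ge0 (_ : _ - _ = (2 - 2 * c) * (1 - a ^+ 2 - b ^+ 2)) ?mulr_ge0//.
by ring: s2.
Qed.
End PlaneRotation.

(** Removing the two plane components and adding the rotated ones amounts to adding their
    differences. *)
Lemma rotationE u w t v :
  rotation dot u w t v = plane_rotation (hat dot u w) w (cos t) (sin t) v.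
Proof.
rewrite /rotation /plane_rotation; set h := hat dot u w.
set a := dot h v; set b := dot w v.
set x := cos t * a - sin t * b; set y := sin t * a + cos t * b.
have -> : (cos t - 1) * a - sin t * b = - a + x by rewrite /x; ring.
have -> : sin t * a + (cos t - 1) * b = - b + y by rewrite /y; ring.
by rewrite !scalerDl !scaleNr [in RHS]addrACA !addrA.
Qed.

(** * The rotation carrying one unit vector to another *)

Section Hat.
Variables (u w : V).
Hypotheses (uu : dot u u = 1) (ww : dot w w = 1) (uw : u != w) (uNw : u != - w).

Let d := u - dot w u *: w.

Let d_neq0 : d != 0.
Proof.
(* If [d = 0], then [u] is a multiple of [w], and unit length forces the factor to be 1 or -1. *)
apply/negP; rewrite subr_eq0 => /eqP uE.
have := uu; rewrite uE !dotE ww mulr1 -expr2 => /eqP; rewrite sqrf_eq1.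
case/orP=> /eqP b1; move: uw uNw; rewrite uE b1 ?scale1r ?scaleN1r ?eqxx//.
Qed.

Lemma hat_unit : dot (hat dot u w) (hat dot u w) = 1.
Proof. exact: dnorm_normalize. Qed.

Lemma hat_orthogonal : dot (hat dot u w) w = 0.
Proof. by rewrite /hat !dotE ww (dotC u w) mulr1 subrr mulr0. Qed.

(** The component of [u] along the hat vector is the norm of [d], which is positive, so the sign
    factor in the angle is 1. The angle then has cosine [dot w u] and sine the norm of [d]: the hat
    component cancels and the [w] component becomes 1. *)
Lemma rotation_to : rotation dot u w (rotation_angle dot u w) u = w.
Proof.
have dd : dot d d = 1 - dot w u ^+ 2.
  by rewrite /d !dotE uu ww (dotC u w); ring.
have d2 := dot_gt0 d_neq0.
have n_gt0 : 0 < dnorm dot d by rewrite sqrtr_gt0.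
have hu : dot (hat dot u w) u = dnorm dot d.
  apply: (mulfI (lt0r_neq0 n_gt0)); rewrite /hat dotZl mulVKf ?lt0r_neq0//.
  rewrite -expr2 sqr_sqrtr ?dot_ge0// dd /d.
  by rewrite !dotE uu; ring.
have w_itv : -1 <= dot w u <= 1.
  by apply/andP; split; nra.
have nh : dnorm dot d *: hat dot u w = d.
  by rewrite /hat scalerA mulfV ?scale1r// gt_eqF.
have n2 : dnorm dot d ^+ 2 = 1 - dot w u ^+ 2 by rewrite sqr_sqrtr ?dot_ge0.
have sin_n : sin (acos (dot w u)) = dnorm dot d by rewrite sin_acos// -dd.
rewrite rotationE /rotation_angle hu gtr0_norm// divff ?gt_eqF// mul1r.
rewrite acosK ?in_itv// sin_n /plane_rotation hu.
rewrite (_ : _ - _ = - dnorm dot d); last by ring.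
rewrite (_ : _ * _ + _ = 1 - dot w u); last by ring: n2.
rewrite scaleNr nh /d scalerBl scale1r opprB.
by rewrite addrCA addrA subrK addrCA subrr addr0.
Qed.

Lemma hat_mem (U : {vspace V}) : u \in U -> w \in U -> hat dot u w \in U.
Proof. by move=> uU wU; rewrite memvZ ?memvB ?memvZ. Qed.

End Hat.

(** * Dropping the last basis vector, and perturbing an exceptional basis *)

Local Notation widen i := (widen_ord (leqnSn _) i).

Lemma onb_init_expand k (e : k.+1.-tuple V) x : ordered_onb dot <<e>> e -> x \in <<e>>%VS ->
  dot (tnth e ord_max) x = 0 -> x \in <<[tuple tnth e (widen i) | i < k]>>%VS.
Proof.
move=> eU xU ex; rewrite (onb_expand eU xU) big_ord_recr/= ex scale0r addr0.
apply: memv_suml => i _; rewrite memvZ// memv_span//.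
by rewrite -(tnth_mktuple (fun i => tnth e (widen i)) i) mem_tnth.
Qed.

(** The rotation preserves the determinant and sends [un] to [en]. The other rotated vectors are
    therefore orthogonal to [en], hence lie in the span of [e'], and the last column of the rotated
    Gram matrix allows [det_last_col]. *)
Lemma onb_reduction k (e u : k.+1.-tuple V) (en := tnth e ord_max)
    (un := tnth u ord_max) (T := rotation_angle dot un en)
    (e' := [tuple tnth e (widen i) | i < k])
    (u' := [tuple rotation dot un en T (tnth u (widen i)) | i < k]) :
  ordered_onb dot <<e>> e -> ordered_onb dot <<e>> u -> un != en -> un != - en ->
  [/\ ordered_onb dot <<e'>> e', ordered_onb dot <<e'>> u' &
      \det (gram e u) = \det (gram e' u')].
Proof.
move=> eU uU uen uNen.
have [dimU einU oe] := ordered_onbP _ _ eU; have [_ uinU ou] := ordered_onbP _ _ uU.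
have unun : dot un un = 1 by rewrite ou eqxx.
have enen : dot en en = 1 by rewrite oe eqxx.
have hh := hat_unit unun enen uen uNen.
have hw := hat_orthogonal un enen.
have hU : hat dot un en \in <<e>>%VS := hat_mem (uinU _) (einU _).
have enU : en \in <<e>>%VS := einU _.
set rot := plane_rotation (hat dot un en) en (cos T) (sin T).
have urU : ordered_onb dot <<e>> [tuple rot (tnth u i) | i < k.+1].
  by apply: plane_rotation_onb => //; exact: cos2Dsin2.
have [_ urinU our] := ordered_onbP _ _ urU.
have rot_un : rot un = en by rewrite /rot -rotationE rotation_to.
have en_rot i : dot en (rot (tnth u i)) = (ord_max == i)%:R.
  by rewrite -rot_un dot_plane_rotation ?ou// cos2Dsin2.
have e'U : ordered_onb dot <<e'>> e'.
  by apply: ordered_onb_span => i j; rewrite !tnth_mktuple oe.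
have [dimU' _ _] := ordered_onbP _ _ e'U.
split=> //.
  apply/ordered_onbP; split=> // [i|i j]; rewrite !tnth_mktuple !rotationE.
    apply: onb_init_expand => //; first by have := urinU (widen i); rewrite tnth_mktuple.
    by rewrite en_rot -val_eqE/= gtn_eqF.
  by have := our (widen i) (widen j); rewrite !tnth_mktuple.
rewrite -(det_gram_plane_rotation hh enen hw T hU enU eU uU) det_last_col.
  by congr (\det _); apply/matrixP => i j; rewrite !mxE !tnth_mktuple rotationE.
move=> i; rewrite mxE tnth_mktuple -/un; rewrite -/(rot un) rot_un oe.
by [].
Qed.

(** The length [k.+2] makes the first and last vectors of [e] distinct, so there is a plane in which
    to rotate the last vector of [u] away from both exceptional positions. *)
Lemma onb_perturbation (U : {vspace V}) k (e u : k.+2.-tuple V) (eps : R) :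
  ordered_onb dot U e -> ordered_onb dot U u -> 0 < eps ->
  (tnth u ord_max == tnth e ord_max) || (tnth u ord_max == - tnth e ord_max) ->
  exists x : k.+2.-tuple V, [/\ ordered_onb dot U x,
    forall i, dnorm dot (tnth x i - tnth u i) < eps,
    tnth x ord_max != tnth e ord_max & tnth x ord_max != - tnth e ord_max].
Proof.
move=> eU uU eps0 uen.
have [_ einU oe] := ordered_onbP _ _ eU; have [_ _ ou] := ordered_onbP _ _ uU.
set h := tnth e ord0; set w := tnth e ord_max in uen *.
have hh : dot h h = 1 by rewrite oe.
have ww : dot w w = 1 by rewrite oe eqxx.
have hw : dot h w = 0 by rewrite oe.
(* rotate by the angle of cosine 1 - d, which moves unit vectors by at most
   sqrt (2 d) < eps *)
pose d := Num.min 1 (eps ^+ 2 / 4).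
have d0 : 0 < d by rewrite lt_min ltr01 divr_gt0 ?exprn_gt0.
have d1 : d <= 1 by rewrite ge_min lexx.
have deps : d <= eps ^+ 2 / 4 by rewrite ge_min lexx orbT.
pose c := 1 - d; pose s := Num.sqrt (1 - c ^+ 2).
have c2 : 0 < 1 - c ^+ 2 by rewrite /c; nra.
have cs : c ^+ 2 + s ^+ 2 = 1 by rewrite /s sqr_sqrtr ?ltW// addrC subrK.
have s0 : s != 0 by rewrite gt_eqF// sqrtr_gt0.
exists [tuple plane_rotation h w c s (tnth u i) | i < k.+2].
(* The [h] component of the rotated last vector is [s] or [- s], whereas [w] and [- w] have none. *)
have hx : dot h (tnth [tuple plane_rotation h w c s (tnth u i) | i < k.+2] ord_max) != 0.
  rewrite tnth_mktuple dot_plane_rotationl//.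
  by case/orP: uen => /eqP->; rewrite ?dotNr hw ww ?oppr0 mulr0 add0r ?mulrN ?mulr1 ?opprK ?oppr_eq0.
split.
- by apply: plane_rotation_onb => //; rewrite einU.
- move=> i; rewrite tnth_mktuple.
  apply: le_lt_trans (dnorm_plane_rotationB hh ww hw cs _ _) _.
  + by rewrite /c; lra.
  + by rewrite ou eqxx.
  rewrite -(gtr0_norm eps0) -sqrtr_sqr ltr_sqrt ?exprn_gt0// /c.
  have : 0 < eps ^+ 2 by rewrite exprn_gt0.
  by lra.
- by apply: contraNneq hx => ->; rewrite hw.
- by apply: contraNneq hx => ->; rewrite dotNr hw oppr0.
Qed.

(** * Orientation as a determinant *)

Lemma onb_orientation_gram n (e u : n.-tuple V) : (0 < n)%N ->
  ordered_onb dot <<e>> e -> ordered_onb dot <<e>> u ->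
  onb_orientation dot e u = \det (gram e u).
Proof.
elim: n => // -[|[|n]] IHn in e u * => _ eU uU.
(* Dimension 1: the vector of [u] is its determinant, 1 or -1, times that of [e]. *)
- have [_ _ oe] := ordered_onbP _ _ eU; have [_ uinU _] := ordered_onbP _ _ uU.
  have := det_gram_sqr eU uU; rewrite det_mx11 mxE /= => /eqP.
  have := onb_expand eU (uinU ord_max); rewrite big_ord1.
  have -> : ord0 = ord_max :> 'I_1 by apply/val_inj.
  have -> : 0 = ord_max :> 'I_1 by apply/val_inj.
  set w := tnth e ord_max; set v := tnth u ord_max => vE; rewrite sqrf_eq1.
  have ww : dot w w = 1 by rewrite oe.
  case/orP=> /eqP wv; rewrite wv vE wv ?scale1r ?eqxx// scaleN1r.
  by case: eqP => // /(congr1 (dot w)); rewrite dotNr ww; lra.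
- have [_ _ oe] := ordered_onbP _ _ eU; have [_ uinU ou] := ordered_onbP _ _ uU.
  have := det_gram_sqr eU uU; rewrite det_mx22 !mxE /= => /eqP.
  have := dot_onb_sqr eU (uinU ord_max); rewrite ou eqxx.
  have := ou ord0 ord_max; rewrite {1}(onb_expand eU (uinU ord0)) dot_suml.
  rewrite !big_ord_recl !big_ord0 !addr0.
  have -> : lift ord0 ord0 = ord_max :> 'I_2 by apply/val_inj.
  rewrite !dotZl /=.
  set h := tnth e ord0; set w := tnth e ord_max.
  set x := tnth u ord0; set y := tnth u ord_max.
  set p := dot h x; set q := dot w x; set a := dot h y; set b := dot w y.
  move=> xy yy detE.
  have b_itv : -1 <= b <= 1 by apply/andP; split; nra.
  (* Dimension 2: the angle has cosine [b] and sine [a], so the [w] coefficient of the rotated [x]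
     is [dot x y = 0] and the [h] coefficient is the determinant. *)
  have -> : rotation2 dot h w (rotation2_angle dot h w y) x = (p * b - a * q) *: h.
    rewrite /rotation2.
    have [-> ->] : cos (rotation2_angle dot h w y) = b /\
                   sin (rotation2_angle dot h w y) = a.
      have a2 : 1 - b ^+ 2 = a ^+ 2 by apply/eqP; rewrite subr_eq; apply/eqP; exact: yy.
      (* The sine of [acos b] is the absolute value of [a]; the sign factor restores the sign, and
         its choice is immaterial to the sine when [a = 0]. *)
      rewrite /rotation2_angle -/a -/b; case: ifPn => [/eqP a0|a_neq0].
        by rewrite mul1r acosK ?in_itv// sin_acos// a2 a0 expr0n sqrtr0.
      have [a_gt0|a_lt0|a0] := ltrgt0P a; last by rewrite a0 eqxx in a_neq0.
        by rewrite divff// mul1r acosK ?in_itv// sin_acos// a2 sqrtr_sqr gtr0_norm.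
      rewrite invrN mulrN divff// mulN1r cosN sinN acosK ?in_itv// sin_acos// a2.
      by rewrite sqrtr_sqr ltr0_norm// opprK.
    by rewrite -/p -/q [a * p]mulrC [b * q]mulrC xy scale0r addr0 (mulrC b).
  move: detE; rewrite sqrf_eq1 => /orP[] /eqP ->; rewrite ?scale1r ?eqxx//.
  rewrite scaleN1r; case: eqP => // /(congr1 (dot h)).
  by rewrite dotNr (_ : dot h h = 1) ?oe//; lra.
(* Dimension at least 3: [generic] names the recursive value, computed by the induction
   hypothesis. *)
set e' := [tuple tnth e (widen i) | i < n.+2].
pose generic (x : n.+3.-tuple V) := onb_orientation dot e'
  [tuple rotation dot (tnth x ord_max) (tnth e ord_max)
     (rotation_angle dot (tnth x ord_max) (tnth e ord_max)) (tnth x (widen i)) | i < n.+2].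
have genericE x : ordered_onb dot <<e>> x -> tnth x ord_max != tnth e ord_max ->
    tnth x ord_max != - tnth e ord_max -> generic x = \det (gram e x).
  move=> xU xe xNe; have [e'U x'U ->] := onb_reduction eU xU xe xNe.
  exact: IHn.
have -> : onb_orientation dot e u =
    if (tnth u ord_max == tnth e ord_max) || (tnth u ord_max == - tnth e ord_max)
    then xget 1 [set s : R | exists2 eps : R, 0 < eps &
      forall x : n.+3.-tuple V, ordered_onb dot <<e>>%VS x ->
        (forall i, dnorm dot (tnth x i - tnth u i) < eps) ->
        tnth x ord_max != tnth e ord_max -> tnth x ord_max != - tnth e ord_max ->
        generic x = s]%classic
    else generic u.
  by [].
case: ifPn => [uen|]; last by rewrite negb_or => /andP[]; exact: genericE.
(* With this radius the bound in [det_gram_near] equals 1, which is less than 2. *)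
pose eps0 : R := ((n.+3)`! * n.+3)%:R^-1.
have N0 : 0 < ((n.+3)`! * n.+3)%:R :> R by rewrite ltr0n muln_gt0 fact_gt0.
have eps0_gt0 : 0 < eps0 by rewrite invr_gt0.
have near x : ordered_onb dot <<e>> x ->
    (forall i, dnorm dot (tnth x i - tnth u i) < eps0) ->
    \det (gram e x) = \det (gram e u).
  move=> xU xu; apply: (det_gram_near eU uU xU (fun i => ltW (xu i))).
  by rewrite mulfV ?gt_eqF// ltr1n.
(* The default of [xget] is excluded because the determinant of [u] is a common value with radius
   [eps0]. Any selected [s] equals it, by evaluation at one perturbed basis within both radii. *)
case: xgetP => [s _ [eps eps_gt0 epsP]|/(_ (\det (gram e u)))[]]; last first.
  by exists eps0 => // x xU xu xe xNe; rewrite genericE// near.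
have min_gt0 : 0 < Num.min eps eps0 by rewrite lt_min eps_gt0.
have [x [xU xu xe xNe]] := onb_perturbation eU uU min_gt0 uen.
rewrite -(near x) => // [|i]; last by rewrite (lt_le_trans (xu i))// ge_min lexx orbT.
rewrite -(genericE x)// epsP// => i.
by rewrite (lt_le_trans (xu i))// ge_min lexx.
Qed.

(** * Gram-Schmidt under scaling of one vector *)

(** Later steps see [b] only through the projection [dot v b *: b], which is quadratic in [b], so
    the factor [c] cancels and both runs append the same vectors. *)
Lemma foldl_gram_schmidt_scale (s p q : seq V) b c : c * c = 1 ->
  exists q', foldl (gram_schmidt_step dot) (p ++ b :: q) s = p ++ b :: q' /\
    foldl (gram_schmidt_step dot) (p ++ c *: b :: q) s = p ++ c *: b :: q'.
Proof.
move=> cc; elim: s q => [|v s IHs] q; first by exists q.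
have step x : gram_schmidt_step dot (p ++ x :: q) v = p ++ x :: rcons q
    (let w := v - \sum_(y <- p ++ x :: q) dot v y *: y in (dnorm dot w)^-1 *: w).
  by rewrite /gram_schmidt_step /= rcons_cat.
rewrite /= !step; have -> : \sum_(y <- p ++ c *: b :: q) dot v y *: y
    = \sum_(y <- p ++ b :: q) dot v y *: y.
  by rewrite !big_cat !big_cons /= dotZr scalerA mulrAC cc mul1r.
exact: IHs.
Qed.

(** The residual [w] of [a] becomes [t *: w], and normalizing leaves the factor [t / |t|], of square
    1; the previous lemma handles the tail [s2]. *)
Lemma gram_schmidt_scale (s1 s2 : seq V) a (t : R) : t != 0 ->
  exists q1 q2 b, [/\ size q1 = size s1,
    gram_schmidt dot (s1 ++ a :: s2) = q1 ++ b :: q2 &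
    gram_schmidt dot (s1 ++ t *: a :: s2) = q1 ++ (t / `|t|) *: b :: q2].
Proof.
move=> t0; rewrite /gram_schmidt !foldl_cat /= -/(gram_schmidt dot s1).
set q1 := gram_schmidt dot s1.
set w := a - \sum_(u <- q1) dot a u *: u.
have -> : gram_schmidt_step dot q1 (t *: a) =
    rcons q1 ((t / `|t|) *: ((dnorm dot w)^-1 *: w)).
  rewrite /gram_schmidt_step.
  have -> : t *: a - \sum_(u <- q1) dot (t *: a) u *: u = t *: w.
    rewrite scalerBr scaler_sumr; congr (_ - _).
    by apply: eq_bigr => u _; rewrite dotZl scalerA.
  by rewrite /= dnormZ !scalerA invfM; congr (rcons _ (_ *: _)); ring.
rewrite /gram_schmidt_step -/w /= -!cats1.
have cc : (t / `|t|) * (t / `|t|) = 1.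
  by rewrite -expr2 expr_div_n -normrX ger0_norm ?sqr_ge0// divff ?expf_neq0.
have [q [E1 E2]] := foldl_gram_schmidt_scale s2 q1 [::] ((dnorm dot w)^-1 *: w) cc.
exists q1, q, ((dnorm dot w)^-1 *: w); split=> //.
exact: size_gram_schmidt.
Qed.

(** The span inclusion is carried through the induction because it gives [w != 0]: a zero residual
    would put [v] in the span of the earlier vectors. *)
Lemma gram_schmidt_orthonormal (s : seq V) : free s ->
  orthonormal dot (gram_schmidt dot s) /\
  {subset gram_schmidt dot s <= << s >>%VS}.
Proof.
elim/last_ind: s => [//|s v IHs].
have /perm_free-> : perm_eq (rcons s v) (v :: s) by rewrite perm_rcons.
rewrite free_cons -cats1 => /andP[vs /IHs[os sub]].
rewrite /gram_schmidt foldl_cat -/(gram_schmidt dot s) /=.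
set q := gram_schmidt dot s in os sub *; rewrite /gram_schmidt_step.
set w := v - _.
have sumq : \sum_(u <- q) dot v u *: u \in << s>>%VS.
  by rewrite big_seq; apply: memv_suml => u /sub us; rewrite memvZ.
have w0 : w != 0 by apply: contraNneq vs => /subr0_eq ->.
have subs x : x \in << s>>%VS -> x \in << s ++ [:: v]>>%VS.
  by apply/subvP: x; rewrite span_cat addvSl.
split; last first.
  move=> x; rewrite mem_rcons inE => /orP[/eqP->|/sub/subs//].
  by rewrite memvZ// memvB// ?(subs _ sumq)// memv_span// mem_cat mem_head orbT.
have ouq := orthonormalP _ os.
have qw i : (i < size q)%N -> dot q`_i w = 0.
  move=> iq; rewrite dotDr dotNr dot_sumr (big_nth 0) big_mkord.
  rewrite (bigD1 (Ordinal iq))//= big1 => [|j ji].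
    by rewrite dotZr ouq// eqxx mulr1 addr0 dotC subrr.
  by rewrite dotZr ouq// (_ : (i == j) = false) ?mulr0//; apply: contraNF ji; rewrite eq_sym.
apply/orthonormalP => i j; rewrite size_rcons !ltnS !nth_rcons => iq jq.
case: (ltngtP i (size q)) iq => // iq _; case: (ltngtP j (size q)) jq => // jq _.
- exact: ouq.
- by rewrite dotZr qw// mulr0 jq ltn_eqF.
- by rewrite dotC dotZr qw// mulr0 iq gtn_eqF.
- by rewrite dnorm_normalize// iq jq eqxx.
Qed.

Lemma gram_schmidt_onb k (U : {vspace V}) (v : k.-tuple V) :
  basis_of U v -> ordered_onb dot U (gram_schmidt_tuple dot v).
Proof.
move=> vU; have [ov sub] := gram_schmidt_orthonormal (basis_free vU).
apply/ordered_onbP; split=> [|i|i j]; first exact: size_basis vU.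
  by rewrite -(span_basis vU) sub// mem_tnth.
by rewrite !(tnth_nth 0) (orthonormalP _ ov)// size_gram_schmidt size_tuple.
Qed.

End OrthonormalBases.

(** * Scaling one basis vector *)

Unset Implicit Arguments.

Theorem proposition2p3 (R : realType) (V : vectType R) (dot : {dot V for idfun})
    (n : nat) (n_ge1 : (1 <= n)%N)
    (e : n.-tuple V) (e_onb : ordered_onb dot fullv e)
    (v : n.-tuple V) (v_basis : basis_of fullv v)
    (i : 'I_n) (t : R) (t_neq0 : t != 0) :
  orientation dot e [tuple if j == i then t *: tnth v j else tnth v j | j < n]
  = t / `|t| * orientation dot e v.
Proof.
set v' := [tuple _ | j < n].
have spanE : <<e>>%VS = fullv by case/andP: e_onb => /span_basis.
have onb_e : ordered_onb dot <<e>> e by rewrite spanE.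
have isz : (i < size v)%N by rewrite size_tuple.
have vE : v = take i v ++ tnth v i :: drop i.+1 v :> seq V.
  by rewrite (tnth_nth 0) -drop_nth// cat_take_drop.
have v'E : v' = take i v ++ t *: tnth v i :: drop i.+1 v :> seq V.
  have sz := congr1 size vE; rewrite !size_cat /= size_tuple in sz.
  apply: (@eq_from_nth _ 0) => [|j]; rewrite size_tuple ?size_cat// => jn.
  rewrite -(tnth_nth 0 v' (Ordinal jn)) tnth_mktuple (tnth_nth 0 v (Ordinal jn)) {2}vE.
  rewrite !nth_cat size_takel ?(ltnW isz)// -val_eqE/=.
  case: ltngtP => // [ij|->]; last by rewrite subnn (tnth_nth 0).
  by rewrite -[(j - i)%N]prednK ?subn_gt0.
have [q1 [q2 [b]]] := gram_schmidt_scale dot (take i v) (drop i.+1 v) (tnth v i) t_neq0.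
rewrite size_takel ?(ltnW isz)// -vE -v'E => -[sq1 gv gv'].
(* The list decomposition at position [i], read entry by entry. *)
have gsE k : tnth (gram_schmidt_tuple dot v') k =
    (if k == i then t / `|t| else 1) *: tnth (gram_schmidt_tuple dot v) k.
  rewrite !(tnth_nth 0) /= gv gv' !nth_cat sq1 -val_eqE/=.
  case: ltngtP => [ki|ik|->]; rewrite ?scale1r ?subnn//.
  by rewrite -[(k - i)%N]prednK ?subn_gt0.
have onb_v := gram_schmidt_onb dot v_basis.
have [dimV _ ov] := ordered_onbP _ _ _ onb_v.
(* Orthonormality passes from [v] to [v'] through [gsE], since [t / |t|] has square 1. *)
have onb_v' : ordered_onb dot fullv (gram_schmidt_tuple dot v').
  apply/ordered_onbP; split=> // [k|j k]; first exact: memvf.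
  rewrite !gsE dotZl dotZr ov; case: (eqVneq j k) => [->|]; last by rewrite !mulr0.
  case: ifP => _; rewrite !mulr1//.
  by rewrite -expr2 expr_div_n -normrX ger0_norm ?sqr_ge0// divff ?expf_neq0.
rewrite /orientation !onb_orientation_gram ?spanE//.
(* Both orientations are now determinants, and the Gram matrices differ only by the factor [t / |t|]
   in column [i]. *)
by apply: (@det_scale_col _ _ _ _ i) => j k; rewrite !mxE gsE dotZr.
Qed.
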